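(* For every $m\ge 2$, the generalized wheel graph $W_{m,3}=\overline{K}_m+C_3$ satisfies $\operatorname{nim}(\mathrm{DNT}(W_{m,3}))=1$ and $\operatorname{nim}(\mathrm{TER}(W_{m,3}))=2$.
   Context: The generalized wheel graph $W_{m,n}$ ($m\ge 2$, $n\ge 3$) is the join $\overline{K}_m+C_n$ of the edgeless graph on $m$ vertices and the cycle graph on $n$ vertices, i.e. their disjoint union together with all edges between the two vertex sets ($C_3=K_3$). For a graph $G$ with vertex set $V$, a set $K\subseteq V$ is convex if it contains every vertex lying on any shortest path between two elements of $K$. The convex hull $[P]$ of $P\subseteq V$ is the smallest convex set containing $P$. The game $\mathrm{DNT}(G)$: positions are the sets $P\subseteq V$ with $[V\setminus P]=V$; the starting position is $\emptyset$; the options of $P$ are the sets $P\cup\{v\}$ with $v\in V\setminus P$ and $[V\setminus(P\cup\{v\})]=V$. The game $\mathrm{TER}(G)$: positions are the sets $P\subseteq V$ reachable from the starting position $\emptyset$ by the following moves. If $[V\setminus P]=V$, then the options of $P$ are all sets $P\cup\{v\}$ with $v\in V\setminus P$; if $[V\setminus P]\neq V$, then $P$ is terminal (has no options). The nim-value of a position is defined recursively by $\operatorname{nim}(p)=\operatorname{mex}\{\operatorname{nim}(q): q\text{ an option of }p\}$, where $\operatorname{mex}(A)$ is the smallest nonnegative integer not in $A$; the nim-value of a game is that of its starting position. *)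

(* Defs.v *)
From mathcomp Require Import all_boot.
From mathcomp Require Import boolp.

Set Implicit Arguments.
Unset Strict Implicit.
Unset Printing Implicit Defensive.

(* Graphs are given by their adjacency relation on a finite vertex type. *)

Definition edgeless (m : nat) : rel 'I_m := fun _ _ => false.

(* This is the n-cycle for n >= 3 only: it has a loop at n = 1 and is a single
   edge at n = 2. *)
Definition cycle_graph (n : nat) : rel 'I_n :=
  fun i j => (j == i.+1 %% n :> nat) || (i == j.+1 %% n :> nat).

Definition join_graph (T1 T2 : finType) (e1 : rel T1) (e2 : rel T2) :
    rel (T1 + T2)%type :=
  fun x y => match x, y with
             | inl a, inl b => e1 a b
             | inr a, inr b => e2 a b
             | _, _ => true
             end.

Definition gwheel (m n : nat) : rel ('I_m + 'I_n)%type :=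
  join_graph (@edgeless m) (@cycle_graph n).

Lemma gwheel_sym (m n : nat) : symmetric (@gwheel m n).
Proof. by case=> a [] b //=; apply: orbC. Qed.

Lemma gwheel_irrefl (m n : nat) : 1 < n -> irreflexive (@gwheel m n).
Proof.
move=> n1 [//|i] /=; rewrite /cycle_graph orbb; apply/negbTE.
have := ltn_ord i; rewrite leq_eqVlt => /orP[/eqP iSn|iSn].
  by rewrite iSn modnn; apply: contraTneq n1 => i0; rewrite -iSn i0.
by rewrite modn_small // neq_ltn ltnSn.
Qed.

Section Convexity.
Variables (V : finType) (e : rel V).

(* The walk x :: p is a shortest path from x to y; a walk of minimal length
   never repeats a vertex. *)
Definition shortest_path (x y : V) (p : seq V) : Prop :=
  [/\ path e x p, last x p = y &
      forall q, path e x q -> last x q = y -> size p <= size q].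

Definition convex (K : {set V}) : Prop :=
  forall x y p, x \in K -> y \in K -> shortest_path x y p ->
  forall z, z \in x :: p -> z \in K.

Definition hull (P : {set V}) : {set V} :=
  \bigcap_(K : {set V} | `[< convex K >] && (P \subset K)) K.

Lemma sub_hull (P : {set V}) : P \subset hull P.
Proof. by apply/bigcapsP => K /andP[]. Qed.

Lemma hull_min (P K : {set V}) : convex K -> P \subset K -> hull P \subset K.
Proof. by move=> /asboolP cK PK; apply: bigcap_inf; rewrite cK. Qed.

Lemma hull_convex (P : {set V}) : convex (hull P).
Proof.
move=> x y p /bigcapP xP /bigcapP yP sp z zp; apply/bigcapP => K cPK.
have /andP[/asboolP cK _] := cPK.
exact: (cK _ _ _ (xP _ cPK) (yP _ cPK) sp).
Qed.

Lemma hullT : hull setT = setT.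
Proof. by apply/eqP; rewrite eqEsubset subsetT sub_hull. Qed.

End Convexity.

Lemma mex_exists (s : seq nat) : exists n, n \notin s.
Proof.
exists (sumn s).+1; elim: s => //= a s IH; rewrite inE negb_or.
rewrite neq_ltn ltnS leq_addr orbT /=.
have bound t b : b \in t -> b <= sumn t.
  by elim: t => //= c t IHt; rewrite inE => /orP[/eqP->|/IHt /leq_trans->];
    rewrite ?leq_addr ?leq_addl.
by apply/negP => /bound; rewrite leqNgt ltnS leq_addl.
Qed.

Definition mex (s : seq nat) : nat := ex_minn (mex_exists s).

Lemma eq_mex (s t : seq nat) : s =i t -> mex s = mex t.
Proof. by move=> st; apply: eq_ex_minn => n; rewrite st. Qed.

(* opt p q means that q is an option of p. *)
Record game := Game {
  pos : finType;
  opt : rel pos;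
  start : pos;
  opt_wf : well_founded (fun q p => opt p q)
}.

Section Nim.
Variable G : game.

Definition nim_step (p : pos G) (rec : forall q, opt p q -> nat) : nat :=
  mex [seq rec (val u) (valP u) | u : {q : pos G | opt p q}].

Definition nim : pos G -> nat := Fix (@opt_wf G) (fun=> nat) nim_step.

Lemma nimE p : nim p = mex [seq nim q | q in opt p].
Proof.
rewrite {1}/nim Fix_eq -/nim => [|{}p f g fg].
  apply: eq_mex => n; apply/imageP/imageP => [[u _ ->]|[q pq ->]].
    by exists (val u); first exact: (valP u).
  by exists (Sub q pq).
by rewrite /nim_step; congr mex; apply: eq_map => u; rewrite fg.
Qed.

End Nim.

Definition nim_value (G : game) : nat := nim (start G).

Section Games.
Variables (V : finType) (e : rel V).

Definition compl_generating (P : {set V}) : bool := hull e (~: P) == setT.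

Lemma compl_generating0 : compl_generating set0.
Proof. by rewrite /compl_generating setC0 hullT. Qed.

Definition adds_vertex (P Q : {set V}) : bool :=
  [exists v, (v \notin P) && (Q == v |: P)].

Lemma adds_vertex_wf (T : Type) (f : T -> {set V}) (r : rel T) :
  (forall p q, r p q -> adds_vertex (f p) (f q)) ->
  well_founded (fun q p => r p q).
Proof.
move=> rf p; have [k] := ubnP #|~: f p|; elim: k p => [p|k IH p].
  by rewrite ltn0.
rewrite ltnS => pk; constructor=> q /rf /existsP[v /andP[vp /eqP fq]].
apply/IH/leq_trans/pk/proper_card/properP.
split; first by rewrite setCS fq subsetUr.
by exists v; rewrite in_setC // fq setU11.
Qed.

Definition DNT_pos := {P : {set V} | compl_generating P}.

Definition DNT_opt : rel DNT_pos := fun P Q => adds_vertex (val P) (val Q).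

Definition DNT_start : DNT_pos := Sub set0 compl_generating0.

Definition DNT : game :=
  Game DNT_start (adds_vertex_wf (r := DNT_opt) (fun _ _ => id)).

(* A position with compl_generating P = false admits no move, so it is
   terminal. *)
Definition TER_move : rel {set V} :=
  fun P Q => compl_generating P && adds_vertex P Q.

Definition TER_pos := {P : {set V} | connect TER_move set0 P}.

Definition TER_opt : rel TER_pos := fun P Q => TER_move (val P) (val Q).

Definition TER_start : TER_pos := Sub set0 (connect0 TER_move set0).

Lemma TER_opt_adds P Q : TER_opt P Q -> adds_vertex (val P) (val Q).
Proof. by case/andP. Qed.

Definition TER : game := Game TER_start (adds_vertex_wf TER_opt_adds).

End Games.

(* Main.v *)
Require Import Defs.
From mathcomp Require Import all_boot.

Set Implicit Arguments.
Unset Strict Implicit.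
Unset Printing Implicit Defensive.

(* In the join of m >= 2 independent vertices with a triangle C, each independent
   vertex is simplicial, so its complement is convex and every generating set
   contains it; conversely two independent vertices already generate C.  Hence
   the complement of P generates iff P is contained in C.  Both games then only
   depend on the parity of the number d of elements of C not yet taken: DNT has
   nim-value d mod 2, while in TER the extra losing move out of C, of nim-value
   0, shifts this to d mod 2 + 1. *)

Lemma mex_eq (s : seq nat) (n : nat) :
  n \notin s -> (forall k, k < n -> k \in s) -> mex s = n.
Proof.
move=> ns lt_s; rewrite /mex; case: ex_minnP => k ks kmin.
apply/eqP; rewrite eqn_leq kmin // leqNgt.
by apply: contra ks; apply: lt_s.
Qed.

Lemma nim_eq (G : game) (p : pos G) (n : nat) :
  (forall q, opt p q -> nim q <> n) ->
  (forall k, k < n -> exists2 q, opt p q & nim q = k) -> nim p = n.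
Proof.
move=> neq ex; rewrite nimE; apply: mex_eq => [|k /ex[q pq <-]].
  by apply/imageP => -[q pq nE]; apply: (neq q).
by apply: image_f.
Qed.

Lemma card_setDU1 (V : finType) (C P : {set V}) (v : V) :
  v \in C -> v \notin P -> #|C :\: P| = #|C :\: (v |: P)|.+1.
Proof.
by move=> vC vP; rewrite (cardsD1 v) setDDl [P :|: _]setUC in_setD vP vC.
Qed.

Section GamesBelow.
Variables (V : finType) (e : rel V) (C : {set V}).
Hypothesis genE : forall P, compl_generating e P = (P \subset C).

(** Every legal move takes a vertex of [C], so it lowers [#|C :\: val P|] by one and all options
    share the opposite parity. *)
Lemma nim_DNT (P : pos (DNT e)) : nim P = odd #|C :\: val P|.
Proof.
elim/(well_founded_ind (@opt_wf (DNT e))): P => P IH.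
apply: nim_eq => [Q PQ|k].
  rewrite (IH Q PQ); case/existsP: PQ => v /andP[vP /eqP QE].
  have vC : v \in C.
    by apply: (subsetP (etrans (esym (genE _)) (valP Q))); rewrite QE setU11.
  by rewrite QE (card_setDU1 vC vP) /=; case: odd.
(* Only the value 0 for odd [#|C :\: val P|] is left to realise; oddness makes [C :\: val P]
   nonempty, so a move exists. *)
case dodd: (odd _) => //; case: k => // _.
have /set0Pn[v] : C :\: val P != set0.
  by apply: contraTneq dodd => ->; rewrite cards0.
rewrite in_setD => /andP[vP vC].
have gQ : compl_generating e (v |: val P).
  by rewrite genE subUset sub1set vC -genE (valP P).
pose Q : pos (DNT e) := Sub (v |: val P) gQ.
have PQ : @opt (DNT e) P Q by apply/existsP; exists v; rewrite vP eqxx.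
exists Q => //; rewrite (IH Q PQ).
by move: dodd; rewrite (card_setDU1 vC vP) /=; case: odd.
Qed.

Lemma TER_option (P : pos (TER e)) (v : V) :
    val P \subset C -> v \notin val P ->
  exists2 Q : pos (TER e), opt P Q & val Q = v |: val P.
Proof.
move=> PC vP.
have mPQ : TER_move e (val P) (v |: val P).
  by rewrite /TER_move genE PC; apply/existsP; exists v; rewrite vP eqxx.
by exists (Sub (v |: val P) (connect_trans (valP P) (connect1 mPQ))).
Qed.

(** Positions outside [C] are terminal. Since [C != setT], each position inside [C] has an option of
    value 0, and its options inside [C] all have the other value among 1 and 2. *)
Lemma nim_TER (P : pos (TER e)) : C != setT ->
  nim P = if val P \subset C then (odd #|C :\: val P|).+1 else 0.
Proof.
rewrite -properT => /properP[_ [a _ aC]].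
elim/(well_founded_ind (@opt_wf (TER e))): P => P IH.
have [PC|PC] := ifPn; last first.
  by apply: nim_eq => // Q /andP[]; rewrite genE (negbTE PC).
apply: nim_eq => [Q PQ|k].
  rewrite (IH Q PQ); case: ifP => // QC.
  case/andP: PQ => _ /existsP[v /andP[vP /eqP QE]].
  have vC : v \in C by apply: (subsetP QC); rewrite QE setU11.
  by rewrite QE (card_setDU1 vC vP) /=; case: odd.
(* The value 0 comes from taking [a] outside [C]; the value 1, wanted only for an odd remainder,
   comes from a move inside [C]. *)
case: k => [_|k].
  have aP : a \notin val P by apply: contra aC; apply: (subsetP PC).
  have [Q PQ QE] := TER_option PC aP; exists Q => //.
  by rewrite (IH Q PQ) QE subUset sub1set (negbTE aC).
rewrite ltnS; case dodd: (odd _) => //; case: k => // _.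
have /set0Pn[v] : C :\: val P != set0.
  by apply: contraTneq dodd => ->; rewrite cards0.
rewrite in_setD => /andP[vP vC].
have [Q PQ QE] := TER_option PC vP; exists Q => //.
rewrite (IH Q PQ) QE subUset sub1set vC PC /=.
by move: dodd; rewrite (card_setDU1 vC vP) /=; case: odd.
Qed.

End GamesBelow.

(** A walk passing through [a] can be shortened, since the neighbours of [a] on it are equal or
    adjacent. *)
Lemma convexC1_simplicial (V : finType) (e : rel V) (a : V) :
    (forall u w, e u a -> e a w -> u != w -> e u w) ->
  convex e (~: [set a]).
Proof.
move=> simp x y p; rewrite !in_setC1 => xa ya [ep lp minp] z.
rewrite inE in_setC1 => /orP[/eqP-> //|zp]; apply/eqP => za.
move: zp; rewrite za => /splitPr pE; case: pE ep lp minp => p1 [|w p2].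
  by rewrite last_cat /= => _ ay; rewrite ay eqxx in ya.
rewrite cat_path last_cat /= => /and4P[ep1 ua aw ep2] lp minp.
suff [q eq [lq lt_q]] : exists2 q, path e x q & last x q = y /\
    size q < size (p1 ++ [:: a, w & p2]).
  by have := minp q eq lq; rewrite leqNgt lt_q.
(* If the walk returns to the vertex it came from, the detour [a, w] is cut out; otherwise the edge
   to [w] bypasses [a]. *)
have [uw|uw] := eqVneq (last x p1) w.
  exists (p1 ++ p2); first by rewrite cat_path ep1 uw.
  by rewrite last_cat uw !size_cat ltn_add2l /=.
exists (p1 ++ w :: p2); first by rewrite cat_path ep1 /= simp.
by rewrite last_cat !size_cat ltn_add2l /=.
Qed.

Lemma shortest_path2 (V : finType) (e : rel V) (x y z : V) :
  x != y -> ~~ e x y -> e x z -> e z y -> shortest_path e x y [:: z; y].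
Proof.
move=> xy nxy xz zy; split=> //=; first by rewrite xz zy.
case=> [|u [|//]] /=; first by move=> _ E; rewrite E eqxx in xy.
by rewrite andbT => xu uy; rewrite uy (negbTE nxy) in xu.
Qed.

Lemma cycle_graph3 (i j : 'I_3) : i != j -> cycle_graph i j.
Proof. by move: i j; do 2!case=> [[|[|[|//]]]] ?. Qed.

Definition rim (m n : nat) : {set 'I_m + 'I_n} := [set inr i | i : 'I_n].

Lemma inl_rim (m n : nat) (i : 'I_m) : inl i \notin rim m n.
Proof. by apply/imsetP => -[]. Qed.

Lemma compl_generating_gwheel3 (m : nat) (P : {set 'I_m + 'I_3}) :
  1 < m -> compl_generating (@gwheel m 3) P = (P \subset rim m 3).
Proof.
move=> m1; apply/idP/subsetP => [gP [i iP|j _]|PC].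
- have cK : convex (@gwheel m 3) (~: [set inl i]).
    (* All neighbours of [inl i] lie on the rim, which is complete because it is a triangle. *)
    apply: convexC1_simplicial => -[//|u] [//|w] _ _ uw.
    by apply: cycle_graph3; apply: contra_neq uw => ->.
  have PK : ~: P \subset ~: [set inl i] by rewrite setCS sub1set.
  have /subsetP/(_ (inl i)) := hull_min cK PK.
  by rewrite (eqP gP) in_setT in_setC1 eqxx => /(_ isT).
- exact: imset_f.
have inlH i : inl i \in hull (@gwheel m 3) (~: P).
  apply: (subsetP (sub_hull _ _)); rewrite in_setC.
  exact: contra (PC _) (inl_rim _ i).
rewrite /compl_generating -subTset; apply/subsetP => -[i|j] _; first exact: inlH.
(* The vertices 0 and 1 of the edgeless part are distinct and nonadjacent, so every rim vertex is
   the midpoint of a shortest path between them. *)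
pose a0 := Ordinal (ltnW m1); pose a1 := Ordinal m1.
have sp : shortest_path (@gwheel m 3) (inl a0) (inl a1) [:: inr j; inl a1].
  exact: shortest_path2.
by apply: (hull_convex (inlH a0) (inlH a1) sp); rewrite !inE eqxx orbT.
Qed.

Theorem proposition5p30 (m : nat) (hm : 2 <= m) :
  nim_value (DNT (@gwheel m 3)) = 1 /\ nim_value (TER (@gwheel m 3)) = 2.
Proof.
have genE P := compl_generating_gwheel3 P hm.
have card_rim : #|rim m 3| = 3 by rewrite card_imset ?card_ord // => i j [].
have rimT : rim m 3 != setT.
  apply/eqP => rimT; have := inl_rim 3 (Ordinal (ltnW hm)).
  by rewrite rimT in_setT.
rewrite /nim_value (nim_DNT genE) (nim_TER genE _ rimT) /=.
by rewrite sub0set setD0 card_rim.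
Qed.
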